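(* Let $q$ be a prime power and $h$ a positive integer. Let $\mathcal C$ be a faithful hypergraphic additive code over $\mathbb F_{q^h}$ of $\mathbb F_q$-dimension $k$ with connected underlying $(h+1)$-uniform hypergraph $H$, let $d:=d(\mathcal C)$ be its minimum distance, and let $t\ge1$ be an integer. With the convention $0^0:=1$, the following hold. (i) If $d^\perp(\mathcal C)\ge2t+1$, then $k\ge h\,d\sum_{j=0}^{t-1}\bigl(h(d-1)\bigr)^j$. (ii) If $d^\perp(\mathcal C)\ge2t$, then $k\ge(h+1)\sum_{j=0}^{t-1}\bigl(h(d-1)\bigr)^j-1$. In particular, $k\ge hd$ if $d^\perp(\mathcal C)\ge3$, $k\ge h+h(h+1)(d-1)$ if $d^\perp(\mathcal C)\ge4$, and $k\ge hd+h^2d(d-1)$ if $d^\perp(\mathcal C)\ge5$.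
   Context: A finite hypergraph is a triple $H=(V,\mathcal E,\psi_H)$ with finite sets $V$, $\mathcal E$ and a map $\psi_H:\mathcal E\to2^V\setminus\{\emptyset\}$ (distinct edges may have the same vertex set; $e$ is identified with $\psi_H(e)$). It is $(h+1)$-uniform if every edge has $h+1$ vertices. Vertices are in the same component if joined by a walk $u_0,e_1,u_1,\ldots,e_\ell,u_\ell$ with $u_{i-1},u_i\in e_i$; $H$ is connected if it has one component. For $A\subseteq\mathcal E$, $\kappa(A)$ is the number of components of $(V,A,\psi_H|_A)$, isolated vertices included, and $f_H(A):=|V|-\kappa(A)$. An additive code $\mathcal C\subseteq\mathbb F_{q^h}^n$ is an $\mathbb F_q$-subspace, of $\mathbb F_q$-dimension $k$; $d(\mathcal C)$ is the minimum Hamming weight of a nonzero codeword. It is nondegenerate (faithful) if every coordinate map $\mathcal C\to\mathbb F_{q^h}$, $c\mapsto c_i$, is nonzero (surjective). For $A\subseteq\{1,\ldots,n\}$, $\mathcal C(A)$ is the subspace of codewords vanishing on $A$ and $\rho_{\mathcal C}(A):=k-\dim_{\mathbb F_q}\mathcal C(A)$. A nondegenerate additive code is hypergraphic if there is a hypergraph $H=(V,\{1,\ldots,n\},\psi_H)$ with $\rho_{\mathcal C}=f_H$; any such $H$ is an underlying hypergraph of $\mathcal C$. Dual distance: let $\widetilde{\mathcal C}\subseteq(\mathbb F_q^h)^n=\mathbb F_q^{hn}$ be the image of $\mathcal C$ under coordinatewise expansion with respect to a fixed $\mathbb F_q$-basis of $\mathbb F_{q^h}$, and $\widetilde{\mathcal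 C}^\perp$ its dual for the standard inner product. For $x=(x_1,\ldots,x_n)\in(\mathbb F_q^h)^n$, $\operatorname{wt}_{\rm F}(x)=|\{i:x_i\ne0\}|$. Then $d^\perp(\mathcal C):=\min\{\operatorname{wt}_{\rm F}(x):0\ne x\in\widetilde{\mathcal C}^\perp\}$, and $\infty$ if $\widetilde{\mathcal C}^\perp=0$. *)

(* Defs.v *)
From HB Require Import structures.
From mathcomp Require Import all_boot all_order all_algebra all_field.

Set Implicit Arguments.
Unset Strict Implicit.
Unset Printing Implicit Defensive.

Import GRing.Theory.
Local Open Scope ring_scope.

(* Distinct edges may have the same set of ends. *)
Record hypergraph (V E : finType) := Hypergraph {
  ends :> E -> {set V};
  ends_neq0 : forall e, ends e != set0
}.

Section Hypergraph.
Variables (V E : finType) (H : hypergraph V E).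

Definition adj (A : {set E}) : rel V :=
  fun u v => [exists e in A, (u \in H e) && (v \in H e)].

(* adj A is symmetric, so n_comp counts the classes of connect (adj A);
   a vertex lying on no edge of A is a class by itself. *)
Definition kappa (A : {set E}) : nat := n_comp (adj A) predT.

(* The truncated subtraction is exact: kappa A <= #|V|. *)
Definition hrank (A : {set E}) : nat := (#|V| - kappa A)%N.

Definition hconnected : Prop := kappa [set: E] = 1%N.

Definition uniform (r : nat) : Prop := forall e, #|H e| = r.

End Hypergraph.

(* The field F_{q^h} is an extension L of F = F_q with \dim {:L} = h, and
   words of length n over L are finite functions, as this gives them the
   structure of an F-vector space (matrices over L are only L-modules). *)

Definition hwt (n : nat) (M : zmodType) (x : {ffun 'I_n -> M}) : nat :=
  #|[set i | x i != 0]|.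

(* Least weight of a nonzero word of S; None (infinity) if there is none.
   finvect_type is the identity on types and makes the space a finType. *)
Definition min_weight (F : finFieldType) (M : vectType F) (n : nat)
    (S : {pred {ffun 'I_n -> M}}) : option nat :=
  let P := [pred x : finvect_type {ffun 'I_n -> M} | (x \in S) && (x != 0)] in
  if [pick x | P x] is Some x0 then Some (hwt [arg min_(x < x0 | P x) hwt x])
  else None.

(* m <= w in the natural numbers extended with None as infinity. *)
Definition at_least (m : nat) (w : option nat) : bool :=
  if w is Some d then (m <= d)%N else true.

Section AdditiveCode.
Variables (F : finFieldType) (L : fieldExtType F) (n : nat).

Definition coordinate (i : 'I_n) (c : {ffun 'I_n -> L}) : L := c i.

Fact coordinate_is_linear i : linear (coordinate i).
Proof. by move=> a x y; rewrite /coordinate !ffunE. Qed.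

HB.instance Definition _ (i : 'I_n) :=
  GRing.isLinear.Build F {ffun 'I_n -> L} L *:%R (coordinate i)
    (coordinate_is_linear i).

Variable C : {vspace {ffun 'I_n -> L}}.

Definition nondegenerate : Prop := forall i, exists2 c, c \in C & c i != 0.

Definition faithful : Prop := forall i x, exists2 c, c \in C & c i = x.

Definition vanishing (A : {set 'I_n}) : {vspace {ffun 'I_n -> L}} :=
  (C :&: \bigcap_(i in A) lker (linfun (coordinate i)))%VS.

(* The truncated subtraction is exact: vanishing A is a subspace of C. *)
Definition crank (A : {set 'I_n}) : nat := (\dim C - \dim (vanishing A))%N.

Definition underlying_hypergraph (V : finType) (H : hypergraph V 'I_n) : Prop :=
  nondegenerate /\ forall A, crank A = hrank H A.

Definition min_distance : option nat := min_weight C.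

Section DualDistance.
Variables (h : nat) (b : h.-tuple L).

Definition expand (c : {ffun 'I_n -> L}) : {ffun 'I_n -> 'rV[F]_h} :=
  [ffun i => \row_j coord b j (c i)].

Fact expand_is_linear : linear expand.
Proof.
move=> a x y; apply/ffunP=> i; apply/rowP=> j.
by rewrite !ffunE !mxE linearP.
Qed.

HB.instance Definition _ :=
  GRing.isLinear.Build F {ffun 'I_n -> L} {ffun 'I_n -> 'rV[F]_h} *:%R
    expand expand_is_linear.

Definition expanded_code : {vspace {ffun 'I_n -> 'rV[F]_h}} :=
  (linfun expand @: C)%VS.

Definition inner (x y : {ffun 'I_n -> 'rV[F]_h}) : F :=
  \sum_i \sum_j x i 0 j * y i 0 j.

Definition dual_code : {pred {ffun 'I_n -> 'rV[F]_h}} :=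
  [pred x | [forall (y | y \in expanded_code), inner x y == 0]].

Definition dual_distance : option nat := min_weight dual_code.

End DualDistance.
End AdditiveCode.

(* Main.v *)
(* A nonzero codeword vanishing off the star of a vertex v exists because deleting
   that star isolates v and so lowers the rank; hence every vertex of H has degree at least d.
   A set J of fewer than d^perp(C) edges has full rank h|J|, so it contains no
   Berge cycle: balls of H around a vertex (or an edge) grow like a tree as long
   as that holds, and since |V| = k + 1 counting the ball gives the bounds. *)

Require Import Defs.
From HB Require Import structures.
From mathcomp Require Import all_boot all_order all_algebra all_field.
From mathcomp Require Import zify.

Set Implicit Arguments.
Unset Strict Implicit.
Unset Printing Implicit Defensive.
Import GRing.Theory.

(** * Components of a hypergraph and the effect of adding one edge *)

Section Connectivity.
Variables (V E : finType) (H : hypergraph V E).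

Lemma adj_sym A : symmetric (adj H A).
Proof. by move=> u v; apply: eq_existsb => e; rewrite (andbC (u \in _)). Qed.

Lemma connect_adj_sym A : connect_sym (adj H A).
Proof. exact/sym_connect_sym/adj_sym. Qed.

Lemma connect_adjS (A B : {set E}) u v :
  A \subset B -> connect (adj H A) u v -> connect (adj H B) u v.
Proof.
move=> /subsetP sAB; apply: connect_sub => {}u {}v /exists_inP[e eA uve].
by apply/connect1/exists_inP; exists e; rewrite ?sAB.
Qed.

Lemma connect_edge (A : {set E}) e u v :
  e \in A -> u \in H e -> v \in H e -> connect (adj H A) u v.
Proof. by move=> eA ue ve; apply/connect1/exists_inP; exists e; rewrite ?ue. Qed.

(** Here [x] is where the walk first enters [e] and [y] where it last leaves it. In the induction, a
    step through [e] discards the entry point of the tail and keeps its exit point. *)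
Lemma connect_setU1 (J : {set E}) e u v :
    connect (adj H (e |: J)) u v ->
  connect (adj H J) u v \/
  exists x y, [/\ x \in H e, y \in H e, connect (adj H J) u x
                & connect (adj H J) y v].
Proof.
case/connectP=> p; elim: p u => [|w p IHp] u /= => [_ -> | ].
  by left; apply: connect0.
case/andP=> /exists_inP[e' /setU1P[-> | e'J] /andP[ue we]] /IHp{}IHp /IHp.
- case=> [wv | [x [y [_ ye _ yv]]]]; right.
    by exists u, w; split.
  by exists u, y; split.
- have uw : connect (adj H J) u w by apply: connect_edge ue we.
  case=> [wv | [x [y [xe ye wx yv]]]]; [left | right].
    exact: connect_trans wv.
  by exists x, y; split=> //; apply: connect_trans wx.
Qed.

(** Every [J]-component met by [e] has a representative in [x0 |: X], so [e] merges at most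
    [#|X| + 1] components into one. *)
Lemma kappa_setU1 (J : {set E}) e x0 (X : {set V}) :
    {in H e, forall x, exists2 y, y \in x0 |: X & connect (adj H J) x y} ->
  kappa H J <= kappa H (e |: J) + #|X|.
Proof.
move=> repX; have sym := connect_adj_sym.
pose R A := [set x | roots (adj H A) x].
have kappaE A : kappa H A = #|R A|.
  by rewrite /kappa /n_comp_mem cardsE; apply: eq_card => x; rewrite !inE andbT.
rewrite !kappaE; pose K := R J :\: [set fingraph.root (adj H J) x | x in X].
have: #|R J| <= #|K| + #|X|.
  rewrite -(cardsID [set fingraph.root (adj H J) x | x in X] (R J)) addnC leq_add2l.
  by apply: leq_trans (leq_imset_card _ _); apply/subset_leq_card/subsetIr.
move=> leRK; apply: leq_trans leRK _; rewrite leq_add2r.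
have repK r x : r \in K -> x \in H e -> connect (adj H J) r x ->
    r = fingraph.root (adj H J) x0.
  rewrite 2!inE => /andP[rX /eqP rR] /repX[y /setU1P[-> xy | yX xy]] rx.
    by rewrite -{1}rR; apply/(fingraph.rootP (sym J))/(connect_trans rx).
  case/imsetP: rX; exists y => //; rewrite -{1}rR.
  exact/(fingraph.rootP (sym J))/(connect_trans rx).
(* Roots in [K] inject into the roots for [e |: J]: two that become identified through [e] both lie
   in components met by [e], and by [repK] both are the root of [x0]. *)
rewrite -(@card_in_imset _ _ (fingraph.root (adj H (e |: J)))) => [|r s rK sK].
  apply/subset_leq_card/subsetP=> _ /imsetP[x _ ->].
  by rewrite inE; apply: (roots_root (sym _)).
move/(fingraph.rootP (sym _))/connect_setU1=> [rs | [x [y [xe ye rx ys]]]].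
  have /setDP[] := rK; have /setDP[] := sK; rewrite !inE => /eqP sR _ /eqP rR _.
  by rewrite -rR -sR; apply/(fingraph.rootP (sym _)).
by rewrite (repK r x) // (repK s y) // sym.
Qed.

Lemma kappa0 : kappa H set0 = #|V|.
Proof.
rewrite /kappa /n_comp_mem; apply: eq_card => x; rewrite !inE andbT /roots.
have /connectP[[|y p] /=] := connect_root (adj H set0) x; first by move=> _ ->; apply/eqP.
by case/andP=> /exists_inP[e]; rewrite inE.
Qed.

(** [v] is a component by itself and any other vertex lies in a second one, so the rank is below the
    value [#|V| - 1] of a connected hypergraph. *)
Lemma hrank_isolated (A : {set E}) v :
  1 < #|V| -> (forall e, e \in A -> v \notin H e) -> (hrank H A).+1 < #|V|.
Proof.
move=> V_gt1 vA; rewrite /hrank; suff: 1 < kappa H A by lia.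
rewrite ltnNge; apply/negP=> /card_le1_eqP eqR.
have sym := connect_adj_sym A.
have [w wv] : exists w, w != v.
  suff /card_gt0P[w wv] : 0 < #|predC1 v| by exists w.
  by rewrite cardC1; lia.
have: connect (adj H A) v w.
  by apply/(fingraph.rootP sym)/eqR; rewrite !inE (roots_root sym).
case/connectP=> [[|x p] /=]; first by move=> _ vw; rewrite vw eqxx in wv.
by case/andP=> /exists_inP[e /vA/negPf->].
Qed.

Variables (h : nat) (H_uniform : uniform H h.+1).

(** Starting from [#|V|] singletons, each edge has [h + 1] vertices and so lowers the number of
    components by at most [h]. *)
Lemma kappa_ge (J : {set E}) : #|V| <= kappa H J + h * #|J|.
Proof.
elim: {J}_.+1 {-2}J (ltnSn #|J|) => // m IHm J.
have [-> | [e eJ]] := set_0Vmem J; first by rewrite kappa0 leq_addr.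
rewrite ltnS (cardsD1 e) eJ => ltJm; apply: leq_trans (IHm _ ltJm) _.
have /set0Pn[x xe] := ends_neq0 H e.
have: kappa H (J :\ e) <= kappa H (e |: (J :\ e)) + #|H e :\ x|.
  by apply: (@kappa_setU1 _ _ x) => y ye; exists y; rewrite ?connect0 // setD1K.
have := H_uniform e; rewrite setD1K // (cardsD1 x (H e)) xe; lia.
Qed.

(** This is the absence of Berge cycles. If distinct [u] and [v] were already joined in [J], then
    [u] would represent [v], and adding [e] would lower the number of components by at most [h - 1],
    leaving the rank short of [h * #|e |: J|]. *)
Lemma independent_edge (J : {set E}) e u v :
    h * #|e |: J| <= hrank H (e |: J) -> e \notin J -> u \in H e -> v \in H e ->
  connect (adj H J) u v -> u = v.
Proof.
move=> indep eJ ue ve uv; apply: contraTeq indep => neq_uv.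
have: kappa H J <= kappa H (e |: J) + #|H e :\ u :\ v|.
  apply: (@kappa_setU1 _ _ u) => y ye; have [-> | nyv] := eqVneq y v.
    by exists u; rewrite ?setU11 // connect_adj_sym.
  by exists y; rewrite ?connect0 // !inE nyv ye andbT orbN.
have := kappa_ge J; have := H_uniform e.
rewrite /hrank cardsU1 eJ (cardsD1 u (H e)) ue (cardsD1 v (H e :\ u)) !inE ve.
rewrite eq_sym neq_uv; lia.
Qed.

End Connectivity.

(** * Tree-like growth of balls and the Moore bounds on the number of vertices *)

Section MooreBound.
Variables (V E : finType) (H : hypergraph V E) (h m d : nat).
Hypothesis H_uniform : uniform H h.+1.
Hypothesis independent : forall J : {set E}, #|J| < m -> h * #|J| <= hrank H J.

Definition star v : {set E} := [set e | v \in H e].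

Hypothesis star_ge : forall v, d <= #|star v|.

Lemma sum_star (W : {set V}) (A : {set E}) :
  \sum_(u in W) #|star u :&: A| = \sum_(e in A) #|H e :&: W|.
Proof.
transitivity (\sum_(u in W) \sum_(e in A) (u \in H e)).
  apply: eq_bigr => u _; rewrite -sum1_card big_mkcond [RHS]big_mkcond.
  by apply: eq_bigr => e _; rewrite !inE; case: (e \in A); case: (u \in H e).
rewrite exchange_big; apply: eq_bigr => e _.
rewrite -sum1_card big_mkcond [RHS]big_mkcond; apply: eq_bigr => u _.
by rewrite inE; case: (u \in W); case: (u \in H e).
Qed.

(** [D] holds the explored edges and [J0] the seed. The seed is kept out of the radius [i]: two
    connections to [r] share it, so together they use at most [2 * i + #|J0|] edges. The set [P] of
    edges stands in for a path. *)
Definition ball (J0 : {set E}) r i (B : {set V}) (D : {set E}) : Prop :=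
  [/\ J0 \subset D, forall e, e \in D -> H e \subset B
    & forall u, u \in B -> exists P : {set E},
        [/\ P \subset D, #|P| <= i & connect (adj H (P :|: J0)) r u]].

Lemma ball_connect J0 r i B D u v : ball J0 r i B D -> u \in B -> v \in B ->
  exists J : {set E}, [/\ J \subset D, #|J| <= 2 * i + #|J0| & connect (adj H J) u v].
Proof.
case=> sJ0D _ path /path[P [sPD leP ru]] /path[Q [sQD leQ rv]].
exists (P :|: Q :|: J0); split; first by rewrite !subUset sPD sQD.
  by have := cardsU (P :|: Q) J0; have := cardsU P Q; lia.
apply: (@connect_trans _ _ r).
  by rewrite connect_adj_sym; apply: connect_adjS ru; rewrite setSU ?subsetUl.
by apply: connect_adjS rv; rewrite setSU ?subsetUr.
Qed.

(** A new edge meeting the ball twice would close a Berge cycle with at most [2 * i + #|J0| + 1]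
    edges. *)
Lemma ball_edge1 J0 r i B D e u v :
    ball J0 r i B D -> 2 * i + #|J0| + 1 < m -> e \notin D ->
  u \in H e -> v \in H e -> u \in B -> v \in B -> u = v.
Proof.
move=> ballB lt_m eD ue ve uB vB.
have [J [sJD leJ uv]] := ball_connect ballB uB vB.
have eJ : e \notin J by apply: contra eD; apply/subsetP.
apply: (independent_edge H_uniform _ eJ ue ve uv); apply: independent; rewrite cardsU1 eJ; lia.
Qed.

(** Two new edges leaving the ball and meeting outside it would close a Berge cycle with at most
    [2 * i + #|J0| + 2] edges. *)
Lemma ball_vertex1 J0 r i B D e e' u u' w :
    ball J0 r i B D -> 2 * i + #|J0| + 2 < m -> e \notin D -> e' \notin D ->
    u \in H e -> u \in B -> u' \in H e' -> u' \in B ->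
  w \in H e -> w \in H e' -> w \notin B -> e = e'.
Proof.
move=> ballB lt_m eD e'D ue uB ue' uB' we we'; apply: contraNeq => neq_e.
have [J [sJD leJ uv]] := ball_connect ballB uB uB'.
have notJ f : f \notin D -> f \notin J by apply: contra; apply/subsetP.
have eJ : e \notin e' |: J by rewrite inE negb_or inE neq_e notJ.
suff <- : u = w by [].
apply: (independent_edge H_uniform _ eJ) => //.
  by apply: independent; rewrite cardsU1 eJ cardsU1 notJ //; lia.
apply: connect_trans (connect_edge (setU11 _ _) ue' we').
by apply: connect_adjS uv; apply: subsetUr.
Qed.

(** Each vertex of the frontier [W] has at least [d - c] unexplored edges, each bringing [h]
    vertices outside [B], and nothing is counted twice since no short cycle exists. New vertices lie
    on one explored edge only, so the next step applies with [c = 1]. *)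
Lemma ball_step J0 r i B D (W : {set V}) c :
    ball J0 r i B D -> 2 * i + #|J0| + 2 < m -> W \subset B ->
    (forall u, u \in W -> #|star u :&: D| <= c) ->
  exists (W' : {set V}) (D' : {set E}),
    [/\ ball J0 r i.+1 (B :|: W') D', #|B :|: W'| = #|B| + #|W'|,
        h * (d - c) * #|W| <= #|W'|
      & forall u, u \in W' -> #|star u :&: D'| <= 1].
Proof.
move=> ballB lt_m sWB starD.
have [sJ0D sDB pathB] := ballB.
pose A := [set e | (e \notin D) && (H e :&: B != set0)].
pose W' := (\bigcup_(e in A) H e) :\: B.
have AP e : e \in A -> e \notin D /\ exists2 u, u \in H e & u \in B.
  by rewrite inE => /andP[? /set0Pn[u /setIP[ue uB]]]; split=> //; exists u.
have starA u : u \in W' -> #|star u :&: A| <= 1.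
  case/setDP=> _ uB; apply/card_le1_eqP=> e e' /setIP[ue eA] /setIP[ue' eA'].
  rewrite !inE in ue ue'.
  have [eD [x xe xB]] := AP e eA; have [eD' [y ye' yB]] := AP e' eA'.
  exact/esym/(ball_vertex1 ballB lt_m eD eD' xe xB ye' yB ue ue' uB).
(* Incidences between [A] and [W'] are counted twice: an edge of [A] has a single vertex in [B],
   hence [h] in [W'], and a vertex of [W'] lies on at most one edge of [A]. *)
have leAW' : h * #|A| <= #|W'|.
  apply: (@leq_trans (\sum_(u in W') #|star u :&: A|)); last first.
    by rewrite -[#|W'|]sum1_card; apply: leq_sum.
  rewrite sum_star.
  rewrite mulnC -sum_nat_const; apply: leq_sum => e eA.
  have [eD [x xe xB]] := AP e eA.
  have : H e :\ x \subset H e :&: W'.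
    apply/subsetP=> y /setD1P[neq_yx ye]; rewrite !inE ye /=; apply/andP; split.
      by apply: contra neq_yx => yB; apply/eqP/(ball_edge1 ballB _ eD); lia.
    by apply/bigcupP; exists e.
  by move/subset_leq_card; have := H_uniform e; rewrite (cardsD1 x) xe; lia.
have leWA : (d - c) * #|W| <= #|A|.
  rewrite -[#|A|]sum1_card mulnC -sum_nat_const.
  apply: (@leq_trans (\sum_(u in W) #|star u :&: A|)).
    apply: leq_sum => u uW; have leD := starD u uW; have := star_ge u.
    have : star u :\: D \subset star u :&: A.
      apply/subsetP=> e; rewrite !inE => /andP[-> ue]; rewrite ue /=.
      by apply/set0Pn; exists u; rewrite inE ue (subsetP sWB).
    by move/subset_leq_card; have := cardsID D (star u); lia.
  rewrite sum_star; apply: leq_sum => e /AP[eD _].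
  apply/card_le1_eqP=> u v /setIP[ue uW] /setIP[ve vW].
  by apply: (ball_edge1 ballB _ eD); rewrite ?(subsetP sWB) //; lia.
exists W', (D :|: A); split.
- split.
  + exact: subset_trans sJ0D (subsetUl _ _).
  + move=> e /setUP[/sDB sHB | eA]; first exact: subset_trans sHB (subsetUl _ _).
    apply/subsetP=> u ue; rewrite !inE; case: (u \in B) => //=.
    by apply/bigcupP; exists e.
  + move=> u /setUP[/pathB[P [sPD leP ru]] | /setDP[/bigcupP[e eA ue] _]].
      exists P; split=> //; last exact: leqW.
      exact: subset_trans sPD (subsetUl _ _).
    have [eD [x xe /pathB[P [sPD leP rx]]]] := AP e eA.
    exists (e |: P); split.
    * by rewrite subUset sub1set inE eA orbT (subset_trans sPD (subsetUl _ _)).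
    * by rewrite cardsU1; case: (e \notin P); lia.
    * apply: (@connect_trans _ _ x); last first.
        by apply: connect_edge xe ue; rewrite !inE eqxx.
      by apply: connect_adjS rx; rewrite setSU ?subsetUr.
- by rewrite cardsU disjoint_setI0 ?cards0 ?subn0 // disjoint_sym disjoints_subset
             subDset setUCr subsetT.
- by rewrite -mulnA; apply: leq_trans leAW'; rewrite leq_mul2l leWA orbT.
(* Edges of [D] lie inside [B] and miss [u], so only edges of [A] remain. *)
- move=> u uW'; apply: leq_trans (starA u uW').
  apply/subset_leq_card/subsetP=> e; rewrite !inE => /andP[ue].
  case/orP=> [/sDB/subsetP/(_ u ue) uB | ->]; last by rewrite ue.
  by case/setDP: uW'; rewrite uB.
Qed.

(** The first layer, grown from all of [B], has at least [h * (d - c) * #|B|] vertices; each later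
    one is larger by a factor of at least [h * (d - 1)]. The layers are disjoint. *)
Lemma ball_bound J0 r B D c s :
    ball J0 r 0 B D -> (forall u, u \in B -> #|star u :&: D| <= c) ->
    2 * s + #|J0| < m ->
  #|B| + h * (d - c) * #|B| * \sum_(0 <= j < s) (h * (d - 1)) ^ j <= #|V|.
Proof.
move=> ballB starD; case: s => [|s] lt_m.
  by rewrite big_geq // muln0 addn0 max_card.
set N := h * _ * _.
(* The induction tracks the outermost layer [W] separately from the whole ball [B']. It starts at
   radius 1, where the constant [c] gives way to 1. *)
suff [W [B' [D' [_ _ _ _ leB]]]] : exists (W B' : {set V}) (D' : {set E}),
    [/\ ball J0 r s.+1 B' D', W \subset B',
        forall u, u \in W -> #|star u :&: D'| <= 1, N * (h * (d - 1)) ^ s <= #|W|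
      & #|B| + N * \sum_(0 <= j < s.+1) (h * (d - 1)) ^ j <= #|B'|].
  exact: leq_trans leB (max_card _).
elim: s lt_m => [|s IHs] lt_m.
  have [|W [D' [ballB' eqB leW starD']]] := ball_step ballB _ (subxx B) starD.
    lia.
  exists W, (B :|: W), D'; split=> //; rewrite ?subsetUr ?muln1 //.
  by rewrite big_nat1 eqB leq_add2l muln1.
have [|W [B1 [D1 [ballB1 sWB1 starD1 leW leB1]]]] := IHs; first lia.
have [|W2 [D2 [ballB2 eqB2 leW2 starD2]]] := ball_step ballB1 _ sWB1 starD1.
  lia.
have {}leW2 : N * (h * (d - 1)) ^ s.+1 <= #|W2|.
  by apply: leq_trans leW2; rewrite expnS mulnCA leq_mul2l leW orbT.
exists W2, (B1 :|: W2), D2; split=> //; first exact: subsetUr.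
by rewrite eqB2 big_nat_recr //= mulnDr addnA leq_add.
Qed.

Lemma moore_bound_vertex (v : V) t : 2 * t < m ->
  1 + h * d * \sum_(0 <= j < t) (h * (d - 1)) ^ j <= #|V|.
Proof.
(* The ball starts from one vertex without explored edges, so [c = 0]. *)
move=> lt_m; have := @ball_bound set0 v [set v] set0 0 t.
rewrite cards1 subn0 muln1 cards0 addn0; apply=> //.
- split=> [|e|u]; rewrite ?sub0set ?inE // => /eqP->.
  by exists set0; rewrite sub0set cards0 connect0.
- by move=> u _; rewrite setI0 cards0.
Qed.

Lemma moore_bound_edge (e : E) t : 0 < t -> 2 * t <= m ->
  h.+1 * \sum_(0 <= j < t) (h * (d - 1)) ^ j <= #|V|.
Proof.
case: t => // t _ le_m; have /set0Pn[r re] := ends_neq0 H e.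
(* The ball starts from the [h + 1] vertices of [e] with [e] explored, so [c = 1]. These vertices
   are the term [j = 0] of the sum, which leaves [t - 1] layers to grow. *)
have := @ball_bound [set e] r (H e) [set e] 1 t.
rewrite H_uniform cards1 => bound.
rewrite big_nat_recl //= expn0; under eq_bigr do rewrite expnS.
rewrite -big_distrr /= mulnDr muln1 mulnA (mulnC h.+1); apply: bound; last lia.
- split=> // [f /set1P-> // | u ue]; exists set0; rewrite sub0set cards0.
  by split=> //; apply: connect_edge re ue; rewrite set0U set11.
- by move=> u _; apply: leq_trans (subset_leq_card (subsetIr _ _)) _; rewrite cards1.
Qed.

End MooreBound.

(** * From minimum and dual distance to the rank function of the code *)

Section Codes.

Lemma min_weight_le (F : finFieldType) (M : vectType F) n
    (S : {pred {ffun 'I_n -> M}}) m (x : {ffun 'I_n -> M}) :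
  at_least m (min_weight S) -> x \in S -> (x != 0)%R -> m <= hwt x.
Proof.
move=> + xS nz_x; rewrite /min_weight; case: pickP => [x0 Px0 /= | /(_ x)]; last first.
  by rewrite /= xS nz_x.
by case: arg_minnP => // y _ /(_ x) min_y /leq_trans-> //; apply: min_y; rewrite /= xS.
Qed.

Lemma min_weight_attained (F : finFieldType) (M : vectType F) n
    (S : {pred {ffun 'I_n -> M}}) m :
  min_weight S = Some m -> exists2 x, x \in S & (x != 0)%R.
Proof. by rewrite /min_weight; case: pickP => // x /andP[xS nz_x] _; exists x. Qed.

Local Open Scope ring_scope.

(** Pairing with a basis of [U] is a linear map from a space of dimension [#|I|] to one of dimension
    [\dim U], so its kernel is nonzero. *)
Lemma annihilator_neq0 (F : fieldType) (I : finType) (U : {vspace {ffun I -> F^o}}) :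
    (\dim U < #|I|)%N ->
  exists2 y : {ffun I -> F^o}, y != 0 & forall x, x \in U -> \sum_i x i * y i = 0.
Proof.
move=> ltUI.
pose f (y : {ffun I -> F^o}) := \row_(r < \dim U) (\sum_i (vbasis U)`_r i * y i).
have f_lin : linear f.
  move=> a y z; apply/rowP=> r; rewrite !mxE mulr_sumr -big_split.
  by apply: eq_bigr => i _; rewrite !ffunE mulrDr mulrCA.
pose fL : {linear _ -> _} := HB.pack f (GRing.isLinear.Build _ _ _ _ f f_lin).
have : lker (linfun fL) != 0%VS.
  apply: contraTneq ltUI => ker0; rewrite -leqNgt.
  have := limg_ker_dim (linfun fL) fullv.
  rewrite capfv ker0 dimv0 add0n dimvf /dim /= muln1 => <-.
  by apply: leq_trans (dimvS (subvf _)) _; rewrite dimvf /dim /= mul1n.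
rewrite -vpick0; set y := vpick _ => nz_y; exists y => // x /coord_vbasis->.
have : y \in lker (linfun fL) by apply: memv_pick.
rewrite memv_ker lfunE /= => /eqP/rowP fy.
under eq_bigr do rewrite sum_ffunE mulr_suml.
rewrite exchange_big big1 // => r _; have := fy r; rewrite !mxE => fyr.
by under eq_bigr do rewrite ffunE -mulrA; rewrite -mulr_sumr fyr mulr0.
Qed.

Variables (F : finFieldType) (L : fieldExtType F) (n : nat).
Variable C : {vspace {ffun 'I_n -> L}}.

Lemma vanishingP (J : {set 'I_n}) c :
  reflect (c \in C /\ forall i, i \in J -> c i = 0) (c \in vanishing C J).
Proof.
rewrite memv_cap (memvE c (\bigcap_(i in J) _)%VS).
apply: (iffP andP) => -[cC]; split=> //.
  move=> i iJ; have /subv_bigcapP/(_ i iJ) := b.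
  by rewrite -memvE memv_ker lfunE => /eqP.
apply/subv_bigcapP => i iJ; rewrite -memvE memv_ker lfunE.
by apply/eqP; apply: b.
Qed.

Lemma crank_setT : crank C [set: 'I_n] = \dim C.
Proof.
rewrite /crank; suff ->: vanishing C [set: 'I_n] = 0%VS by rewrite dimv0 subn0.
apply/eqP; rewrite -subv0; apply/subvP=> c /vanishingP[_ c0]; rewrite memv0.
by apply/eqP/ffunP=> i; rewrite c0 ?ffunE ?inE.
Qed.

(** A rank deficit on the complement of [J] yields a nonzero codeword supported in [J]. *)
Lemma min_distance_le (J : {set 'I_n}) d :
  min_distance C = Some d -> (crank C (~: J) < \dim C)%N -> (d <= #|J|)%N.
Proof.
move=> dC ltC; have : vanishing C (~: J) != 0%VS.
  by apply: contraTneq ltC; rewrite /crank => ->; rewrite dimv0 subn0 ltnn.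
rewrite -vpick0; set c := vpick _ => nz_c.
have /vanishingP[cC c0] : c \in vanishing C (~: J) by apply: memv_pick.
have := @min_weight_le _ _ _ (mem C) d c.
rewrite -[min_weight _]/(min_distance C) dC => /(_ (leqnn d) cC nz_c) le_d.
apply: leq_trans le_d (subset_leq_card _); apply/subsetP=> i; rewrite inE.
by apply: contraNT => iJ; rewrite c0 // inE.
Qed.

Variables (h : nat) (b : h.-tuple L) (b_basis : basis_of {: L} b).

(* A shortfall of rank means that the projection of C to the coordinates in J is
   not surjective; a functional killing its image is a dual word supported on J. *)
Lemma dual_distance_crank m (J : {set 'I_n}) :
  at_least m (dual_distance C b) -> (#|J| < m)%N -> (h * #|J| <= crank C J)%N.
Proof.
move=> dual_m; apply: contraTT; rewrite -!ltnNge ltnS => lt_rank.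
pose I := {p : 'I_n * 'I_h | p.1 \in J}.
pose f (c : {ffun 'I_n -> L}) : {ffun I -> F^o} :=
  [ffun p => coord b (val p).2 (c (val p).1)].
have f_lin : linear f.
  by move=> a x y; apply/ffunP=> p; rewrite !ffunE linearP.
pose fL : {linear _ -> _} := HB.pack f (GRing.isLinear.Build _ _ _ _ f f_lin).
(* A coordinate is zero exactly when its coefficients in [b] are, so [crank C J] is the dimension of
   the image of [C] under [f]. *)
have kerf : vanishing C J = (C :&: lker (linfun fL))%VS.
  apply/vspaceP=> c; apply/vanishingP/memv_capP => -[cC c0]; split=> //.
    rewrite memv_ker lfunE /=; apply/eqP/ffunP=> p.
    by rewrite !ffunE c0 ?linear0 //; apply: (valP p).
  move=> i iJ; move: c0; rewrite memv_ker lfunE /= => /eqP/ffunP c0.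
  rewrite (coord_basis b_basis (memvf (c i))) big1 // => j _.
  by have := c0 (exist _ (i, j) iJ); rewrite !ffunE /= => ->; rewrite scale0r.
have cardI : #|{: I}| = (h * #|J|)%N.
  rewrite card_sig -[h in RHS]card_ord mulnC -cardsT -cardsX.
  by apply: eq_card => -[i j]; rewrite !inE andbT.
have [|y nz_y ann] := @annihilator_neq0 F I (linfun fL @: C)%VS.
  by rewrite cardI; move: lt_rank; rewrite /crank -(limg_ker_dim (linfun fL) C) -kerf addKn.
(* The functional [y] is extended by zero: [insub] succeeds exactly on the pairs with [i \in J]. *)
pose z : {ffun 'I_n -> 'rV[F]_h} :=
  [ffun i => \row_j (if insub (i, j) is Some p then y p else 0)].
have zE (p : I) : z (val p).1 0 (val p).2 = y p.
  by rewrite ffunE mxE -surjective_pairing valK.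
have z0 i j : i \notin J -> z i 0 j = 0.
  by move=> iJ; rewrite ffunE mxE insubN.
(* [z] is a nonzero dual word, so its weight is at least [m], while its support lies in [J]. *)
apply: leq_trans (min_weight_le dual_m (_ : z \in _) _) _.
- apply/forall_inP=> _ /memv_imgP[c cC ->]; rewrite lfunE /inner pair_big /=.
  rewrite (bigID (fun p => p.1 \in J)) /= [X in _ + X]big1 ?addr0; last first.
    by move=> [i j] /= iJ; rewrite z0 // mul0r.
  rewrite (big_sub (fun p : 'I_n * 'I_h => p.1 \in J)) /=; apply/eqP.
  rewrite -[RHS](ann _ (memv_img (linfun fL) cC)); apply: eq_bigr => p _.
  by rewrite zE lfunE /= !ffunE mxE mulrC.
- apply: contra nz_y => /eqP z_0; apply/eqP/ffunP=> p.
  by rewrite -zE z_0 !ffunE mxE.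
apply/subset_leq_card/subsetP=> i; rewrite inE; apply: contraNT => iJ.
by apply/eqP/rowP=> j; rewrite z0 // mxE.
Qed.

End Codes.

Theorem proposition5p4
  (q h : nat) (h_gt0 : (0 < h)%N)
  (F : finFieldType) (cardF : #|F| = q)
  (L : fieldExtType F) (dimL : \dim {: L} = h)
  (b : h.-tuple L) (b_basis : basis_of {: L} b)
  (n : nat) (C : {vspace {ffun 'I_n -> L}})
  (k : nat) (dimC : \dim C = k)
  (C_faithful : faithful C)
  (V : finType) (H : hypergraph V 'I_n)
  (H_underlying : underlying_hypergraph C H)
  (H_connected : hconnected H) (H_uniform : uniform H h.+1)
  (d : nat) (dC : min_distance C = Some d)
  (t : nat) (t_gt0 : (1 <= t)%N) :
  [/\ at_least (2 * t + 1) (dual_distance C b) ->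
        (h * d * \sum_(0 <= j < t) (h * (d - 1)) ^ j <= k)%N,
      at_least (2 * t) (dual_distance C b) ->
        ((h + 1) * (\sum_(0 <= j < t) (h * (d - 1)) ^ j) - 1 <= k)%N,
      at_least 3 (dual_distance C b) -> (h * d <= k)%N,
      at_least 4 (dual_distance C b) ->
        (h + h * (h + 1) * (d - 1) <= k)%N
    & at_least 5 (dual_distance C b) ->
        (h * d + h ^ 2 * d * (d - 1) <= k)%N].
Proof.
case: H_underlying => _ rankE.
have [c0 c0C nz_c0] := min_weight_attained dC.
(* A nonzero codeword has a nonzero coordinate, so an edge exists; it has [h + 1 >= 2] vertices. *)
have e0 : 'I_n.
  have [i _ |c0_0] := pickP (fun i => c0 i != 0%R); first exact: i.
  by case/eqP: nz_c0; apply/ffunP=> i; rewrite ffunE; apply/eqP/negbFE/c0_0.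
have V_gt1 : 1 < #|V| by have := max_card (mem (H e0)); rewrite H_uniform; lia.
have V_card : k.+1 = #|V|.
  by rewrite -dimC -crank_setT rankE /hrank H_connected; lia.
(* Outside its star [v] is isolated, so the rank of the complement of the star is below [k]. *)
have star_ge v : d <= #|star H v|.
  apply: (min_distance_le dC); rewrite rankE dimC -ltnS V_card.
  by apply: (hrank_isolated (v := v)) => // e; rewrite !inE.
have indep m : at_least m (dual_distance C b) ->
    forall J : {set 'I_n}, #|J| < m -> h * #|J| <= hrank H J.
  by move=> dual_m J ltJ; rewrite -rankE; apply: (dual_distance_crank b_basis dual_m).
have v0 : V by have /card_gt0P/sigW[v _] := ltnW V_gt1; exact: v.
have odd_bound s : at_least (2 * s + 1) (dual_distance C b) ->
    h * d * \sum_(0 <= j < s) (h * (d - 1)) ^ j <= k.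
  move=> /indep indep_s; rewrite -ltnS V_card -add1n.
  by apply: (moore_bound_vertex H_uniform indep_s star_ge v0); lia.
have even_bound s : 0 < s -> at_least (2 * s) (dual_distance C b) ->
    (h + 1) * (\sum_(0 <= j < s) (h * (d - 1)) ^ j) - 1 <= k.
  move=> s_gt0 /indep indep_s; rewrite leq_subLR add1n V_card addn1.
  exact: (moore_bound_edge H_uniform indep_s star_ge e0).
(* The special cases are the odd bound with one term, then the even and the odd bound with two terms
   each. *)
split=> [||/(odd_bound 1) | /(even_bound 2 isT) | /(odd_bound 2)].
- exact: odd_bound.
- exact: even_bound.
- by rewrite big_nat1 expn0 muln1.
- by rewrite big_nat_recr //= big_nat1 expn0 expn1; nia.
- by rewrite big_nat_recr //= big_nat1 expn0 expn1; nia.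
Qed.
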